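(* Let $a,b\in\mathbb{Z}$ be such that $f(x)=x^5+ax+b$ is irreducible in $\mathbb{Z}[x]$, and let $\theta$ be a root of $f$. Suppose that $\dfrac{2^8a^5+5^5b^4}{\gcd(2^8a^5,\,5^5b^4)}$ is square-free. Then $\mathbb{Z}[\theta]$ is the full ring of integers of $\mathbb{Q}(\theta)$ if and only if for each prime $p$ dividing $\gcd(2a,5b)$ one of the following conditions holds: (1) $p\mid a$ and $p\mid b$, but $p^2\nmid b$; (2) $p=2$, $2\nmid a$, and $a+b\equiv 1\pmod 4$; (3) $p=5$, $5\nmid b$, and $b\not\equiv 1+a,\ 7+2a,\ 18+3a,\ 24+4a \pmod{25}$. *)

(* Defs.v *)
From HB Require Import structures.
From mathcomp Require Import all_boot all_order all_algebra all_field.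
Set Implicit Arguments. Unset Strict Implicit. Unset Printing Implicit Defensive.
Import Order.TTheory GRing.Theory Num.Theory.
Local Open Scope ring_scope.

Definition quintic (a b : int) : {poly int} := 'X^5 + a%:P * 'X + b%:P.

Definition irreducible_in_Zx (f : {poly int}) : Prop :=
  [/\ f != 0, f \isn't a GRing.unit &
      forall g h : {poly int}, f = g * h ->
        g \is a GRing.unit \/ h \is a GRing.unit].

Definition squarefree (n : nat) : Prop :=
  (0 < n)%N /\ forall p : nat, prime p -> ~~ (p * p %| n)%N.

Definition in_Ztheta (theta x : algC) : Prop :=
  exists q : {poly int}, x = (map_poly intr q).[theta].
Definition in_Qtheta (theta x : algC) : Prop :=
  exists q : {poly rat}, x = (map_poly ratr q).[theta].

Definition Ztheta_is_ring_of_integers (theta : algC) : Prop :=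
  forall x : algC, in_Ztheta theta x <-> (in_Qtheta theta x /\ x \in Aint).

Definition cond_at (a b : int) (p : nat) : Prop :=
  [/\ (p%:Z %| a)%Z, (p%:Z %| b)%Z & ~~ ((p ^ 2)%N%:Z %| b)%Z]
  \/ [/\ p = 2%N, ~~ (2 %| a)%Z & (a + b = 1 %[mod 4])%Z]
  \/ [/\ p = 5%N, ~~ (5 %| b)%Z &
        forall k : int, k \in [:: 1 + a; 7 + 2 * a; 18 + 3 * a; 24 + 4 * a] ->
          (b != k %[mod 25])%Z].

(* Main.v *)
(**
  Write [f = x^5 + a x + b] and fix a prime [p].  Two facts carry the argument.

  If an integer [c] satisfies [p^2 | f c] and [p | f' c], write
  [f = (x - c) h + f c] and [h = (x - c) k + f' c].  Then [eta = h(theta) / p]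
  satisfies [eta^2 = (f' c / p) eta - (f c / p^2) k(theta)], so it is integral,
  and it is not in [Z[theta]] because [h] is not divisible by [f] modulo [p].

  Conversely, suppose that [gcd (f, f')] divides a power of [x - c] modulo [p]
  and that [c] is not singular in the above sense.  If [q(theta) / p] is integral
  then [f] divides a power of [q] modulo [p]; were [f] not to divide [q] itself,
  [c] would be a multiple root modulo [p] and [eta = h(theta) / p] would be
  integral.  Then [(theta - c) eta = - s] with [s = f c / p] prime to [p], and
  homogenising an integral equation of [eta] and evaluating at [x = c] gives
  [f c | s^n], a contradiction.

  When [p] divides [gcd (2a, 5b)], the multiple root is [0], [1] or [- b]
  according to the three conditions.  Otherwise [5 f - x f' = 4 a x + 5 b] shows
  that it is [- 5 b / (4 a)], and a singular [c] would force [p^2] to divide the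
  discriminant [2^8 a^5 + 5^5 b^4].
*)
Require Import Defs.
From HB Require Import structures.
From mathcomp Require Import all_boot all_order all_algebra all_field.
From mathcomp Require Import ring zify.
Set Implicit Arguments. Unset Strict Implicit. Unset Printing Implicit Defensive.
Import Order.TTheory GRing.Theory Num.Theory.
Local Open Scope ring_scope.

Local Notation evalZ x P := (map_poly (intr : int -> algC) P).[x].
Local Notation redZ p P := (map_poly (intr : int -> 'F_p) P).

(** * Algebraic integers and integral polynomial relations *)

Lemma Aint_monic_root (x : algC) : x \in Aint ->
  exists2 P : {poly int}, P \is monic & evalZ x P = 0.
Proof.
move=> /floorpP[P defP].
exists P.
  have := minCpoly_monic x.
  rewrite defP !monicE lead_coef_map_inj //; last exact: intr_inj.
  by rewrite -[X in _ == X -> _]/(1%:~R : algC) eqr_int.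
by rewrite -defP; apply/rootP/root_minCpoly.
Qed.

Lemma evalZ_Aint (x : algC) (P : {poly int}) : x \in Aint -> evalZ x P \in Aint.
Proof.
move=> xA; rewrite horner_coef; apply: rpred_sum => i _.
by rewrite coef_map rpredM ?rpredX ?Aint_int.
Qed.

Lemma Aint_integralOver (x : algC) :
  x \in Aint <-> integralOver (intr : int -> algC) x.
Proof.
split=> [/Aint_monic_root[P mP Px]|[P mP Px]]; first by exists P => //; apply/rootP.
apply: root_monic_Aint Px _ _; first exact: monic_map.
by apply/polyOverP=> i; rewrite coef_map intr_int.
Qed.

(** Transitivity of integrality: [x] is a root of the monic [q = X^2 - (u X + v)], whose
    coefficients are themselves integral. *)
Lemma Aint_quadratic (u v x : algC) :
  u \in Aint -> v \in Aint -> x ^+ 2 = u * x + v -> x \in Aint.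
Proof.
move=> uA vA def_x2; apply/Aint_integralOver.
pose q : {poly algC} := 'X^2 - (u *: 'X + v%:P).
have qE i : q`_i \in Aint.
  rewrite !coefE; case: i => [|[|[|i]]];
    by rewrite /= ?mulr0 ?mulr1 ?addr0 ?add0r ?subr0 ?rpredN ?rpred1 ?rpred0.
have sz : (size (u *: 'X + v%:P)%R < size ('X^2 : {poly algC}))%N.
  rewrite size_polyXn ltnS (leq_trans (size_polyD _ _)) // geq_max.
  rewrite (leq_trans (size_scale_leq _ _)) ?size_polyX //.
  by rewrite (leq_trans (size_polyC_leq1 _)).
have mq : q \is monic by rewrite monicE /q lead_coefDl ?size_polyN ?lead_coefXn.
apply: (integral_root_monic mq).
  by apply/rootP; rewrite !hornerE /= def_x2; ring.
by apply/integral_poly=> i; apply/Aint_integralOver/qE.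
Qed.

(** The remainder [r] of [R] by the monic [f] also vanishes at [x]. By Gauss's lemma the rational
    gcd of [f] and [r] is, up to a scalar, an integral factor [d1] of [f]. If [d1] is a unit, a
    Bezout relation evaluated at [x] gives [1 = 0]; otherwise the gcd has the degree of [f], too
    large to divide a nonzero [r]. *)
Lemma irreducible_dvd_annihilator (f R : {poly int}) (x : algC) :
  irreducible_in_Zx f -> f \is monic -> evalZ x f = 0 -> evalZ x R = 0 ->
  exists E, R = f * E.
Proof.
move=> [f0 fU firr] mf fx Rx.
have := Pdiv.RingMonic.rdivp_eq mf R.
set E := Pdiv.CommonRing.rdivp _ _; set r := Pdiv.CommonRing.rmodp _ _ => defR.
have szr : (size r < size f)%N by exact: Pdiv.Ring.ltn_rmodpN0.
have rx : evalZ x r = 0.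
  by move: Rx; rewrite defR rmorphD rmorphM /= hornerD hornerM fx mulr0 add0r.
exists E; rewrite defR mulrC; suff -> : r = 0 by rewrite addr0.
pose fQ := map_poly (intr : int -> rat) f; pose rQ := map_poly (intr : int -> rat) r.
have ratE (P : {poly int}) :
    map_poly ratr (map_poly (intr : int -> rat) P) = map_poly intr P :> {poly algC}.
  by rewrite -map_poly_comp; apply: eq_map_poly => z /=; rewrite ratr_int.
have [d1 [k k0 defd] [r1 deff]] := dvdpP_rat_int (dvdp_gcdl fQ rQ).
have szd : size (gcdp fQ rQ) = size d1.
  by rewrite defd size_scale // size_map_inj_poly //; exact: intr_inj.
have [ud|ur] := firr _ _ deff.
  have : coprimep fQ rQ.
    rewrite coprimep_def szd; move: ud; rewrite poly_unitE.
    by case/andP=> ->.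
  case/Bezout_eq1_coprimepP=> [[u v]] /=.
  move/(congr1 (fun P => (map_poly ratr P : {poly algC}).[x])).
  rewrite rmorphD !rmorphM /= rmorph1 hornerC !hornerE !ratE fx rx !mulr0 addr0.
  by move/eqP; rewrite eq_sym oner_eq0.
apply/eqP; apply: contraTT szr => r0; rewrite -leqNgt.
have rQ0 : rQ != 0 by rewrite /rQ map_poly_eq0_id0 ?intr_eq0 ?lead_coef_eq0.
have := dvdp_leq rQ0 (dvdp_gcdr fQ rQ).
rewrite szd size_map_inj_poly //; last exact: intr_inj.
rewrite deff; move: ur; rewrite poly_unitE => /andP[/eqP/eqP/size_poly1P[z z0 ->] _].
by rewrite mulrC mul_polyC size_scale.
Qed.

(** Here [y] is formally [B / A] at [x]: multiplying a monic equation of degree [n] for [y] by [A^n]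
    leaves [B^n] plus terms divisible by [A]. *)
Lemma Aint_power_relation (x y : algC) (A B : {poly int}) :
    y \in Aint -> evalZ x A * y = evalZ x B ->
  exists n C, evalZ x (B ^+ n + A * C) = 0.
Proof.
move=> /Aint_monic_root[P mP Py] defB.
pose n := (size P).-1.
have szP : size P = n.+1 by rewrite prednK ?size_poly_gt0 ?monic_neq0.
exists n, (\sum_(i < n) P`_i *: (B ^+ i * A ^+ (n.-1 - i))).
have -> : evalZ x (B ^+ n + A * \sum_(i < n) P`_i *: (B ^+ i * A ^+ (n.-1 - i)))
    = evalZ x A ^+ n * evalZ y P.
  rewrite [evalZ y P]horner_coef size_map_inj_poly ?szP //; last exact: intr_inj.
  rewrite big_ord_recr /= !coef_map /=.
  have -> : P`_n = 1 by move: mP; rewrite monicE lead_coefE szP => /eqP.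
  rewrite mul1r mulrDr -exprMn defB addrC rmorphD rmorphM rmorphXn /=.
  rewrite hornerD hornerM horner_exp rmorph_sum /= horner_sum !mulr_sumr.
  congr (_ + _); apply: eq_bigr => i _.
  rewrite coef_map map_polyZ rmorphM !rmorphXn /= hornerZ hornerM !horner_exp.
  rewrite -defB exprMn.
  have defn : evalZ x A ^+ n = evalZ x A ^+ i * evalZ x A ^+ (n.-1 - i) * evalZ x A.
    by rewrite -exprD -exprSr; congr (_ ^+ _); have := ltn_ord i; lia.
  by rewrite defn; ring.
by rewrite Py mulr0.
Qed.

(** * Reduction of integer polynomials modulo [p] *)

Lemma intr_Fp_eq0 (p : nat) (z : int) : prime p ->
  ((z%:~R : 'F_p) == 0) = (p%:Z %| z)%Z.
Proof. by move=> p_pr; rewrite (dvdz_pcharf (pchar_Fp p_pr)). Qed.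

Lemma redZ_surj (p : nat) (u : {poly 'F_p}) : exists U : {poly int}, redZ p U = u.
Proof.
exists (map_poly (fun z : 'F_p => (z : nat)%:Z) u).
by rewrite map_polyK // => z; rewrite -pmulrn natr_Zp.
Qed.

Lemma redZ_eq (p : nat) (P Q : {poly int}) : prime p ->
  redZ p P = redZ p Q -> exists E, P = Q + p%:Z *: E.
Proof.
move=> p_pr PQ; exists (\poly_(i < maxn (size P) (size Q)) ((P`_i - Q`_i) %/ p%:Z)%Z).
apply/polyP=> i; rewrite coefD coefZ coef_poly.
have dvd_i : (p%:Z %| P`_i - Q`_i)%Z.
  have := congr1 (fun R : {poly 'F_p} => R`_i) PQ; rewrite !coef_map /= => PQi.
  by rewrite -intr_Fp_eq0 // rmorphB /= PQi subrr.
case: ltnP => [_|]; first by rewrite mulrC divzK // addrC subrK.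
by rewrite geq_max => /andP[sP sQ]; rewrite !nth_default ?mulr0 ?addr0.
Qed.

(** * Maximality of [Z[x]] at a prime *)

Lemma taylor_quotient (f : {poly int}) (c : int) :
  exists h k : {poly int},
    f = ('X - c%:P) * h + f.[c]%:P /\ h = ('X - c%:P) * k + (f^`()).[c]%:P.
Proof.
have quot (g : {poly int}) : exists h, g = ('X - c%:P) * h + g.[c]%:P.
  have /factor_theorem[h hE] : root (g - g.[c]%:P) c by rewrite rootE !hornerE subrr.
  by exists h; rewrite mulrC -hE subrK.
have [h hE] := quot f; have [k kE] := quot h.
exists h, k; split=> //.
(* Differentiating [f = (X - c) h + f c] and evaluating at [c] leaves [h c]. *)
suff -> : f^`().[c] = h.[c] by [].
by rewrite {1}hE !derivE !hornerE /= subrr; ring.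
Qed.

Lemma dedekind_local (f : {poly int}) (x : algC) (p : nat) (c : int) (m : nat) :
    prime p -> f \is monic -> x \in Aint -> evalZ x f = 0 ->
    (forall R : {poly int}, evalZ x R = 0 -> exists E, R = f * E) ->
    gcdp (redZ p f) (redZ p f)^`() %| ('X - (c%:~R)%:P) ^+ m ->
    (((p ^ 2)%N%:Z %| f.[c])%Z -> ~~ (p%:Z %| (f^`()).[c])%Z) ->
  forall y, y \in Aint -> in_Ztheta x (p%:R * y) -> in_Ztheta x y.
Proof.
move=> p_pr mf xA fx ann gcd_dvd not_sing y yA [q py].
set F := redZ p f in gcd_dvd *; pose Q := redZ p q.
have mF : F \is monic by exact: monic_map.
have F0 : F != 0 by exact: monic_neq0.
have p0 : p%:R != 0 :> algC by rewrite pnatr_eq0 -lt0n prime_gt0.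
have redp : (p%:Z%:~R : 'F_p) = 0 by apply/eqP; rewrite intr_Fp_eq0.
have [/dvdpP[u defQ]|FnQ] := boolP (F %| Q).
  have [U defU] := redZ_surj u.
  have [E defq] : exists E, q = U * f + p%:Z *: E.
    by apply: redZ_eq => //; rewrite rmorphM /= defU.
  exists E; apply: (mulfI p0); rewrite py defq rmorphD rmorphM /= map_polyZ.
  by rewrite hornerD hornerM hornerZ fx mulr0 add0r.
exfalso.
(* Since [q(x) = p y], the power relation with [A = p] has the form [q^n + p C = f E], whose middle
   term vanishes modulo [p]. *)
have [n FQn] : exists n, F %| Q ^+ n.
  have [|n [C /ann[E defE]]] := @Aint_power_relation x y (p%:Z%:P) q yA.
    by rewrite map_polyC hornerC.
  exists n; apply/dvdpP; exists (redZ p E).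
  have := congr1 (fun P => redZ p P) defE.
  rewrite rmorphD !rmorphM rmorphXn /= map_polyC /= redp mul0r addr0 => ->.
  by rewrite mulrC.
pose g := gcdp Q F.
have [H defF] : exists H, F = H * g by apply/dvdpP; exact: dvdp_gcdr.
pose d := gcdp g H.
(* As [d^2] divides [F], [d] divides [gcd (F, F')], hence a power of [X - c]. If [c] were not a
   root, [d] would be constant and [H] coprime to [g], hence to [Q]; but [H] divides [Q^n], so [H]
   would be constant and [F] would divide [Q]. *)
have d_root : root d (c%:~R : 'F_p).
  apply: contraT => dnr.
  have dF : d * d %| F by rewrite defF dvdp_mul ?dvdp_gcdl ?dvdp_gcdr.
  have d_const : coprimep d d.
    have : d %| ('X - (c%:~R)%:P) ^+ m.
      apply: dvdp_trans gcd_dvd; rewrite dvdp_gcd (dvdp_trans _ dF) ?dvdp_mulIl //=.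
      case/dvdpP: dF => w ->; rewrite derivM derivM.
      by rewrite dvdp_add ?dvdp_mull ?dvdp_add ?dvdp_mulIl ?dvdp_mulIr.
    move/coprimep_dvdl; apply; rewrite coprimep_expr //.
    by rewrite coprimep_XsubC.
  have cHg : coprimep H g by rewrite coprimep_sym coprimep_def -/d -coprimepp.
  have cHQ : coprimep H Q.
    rewrite coprimep_def -coprimepp.
    have e1 : gcdp H Q %| g.
      rewrite dvdp_gcd dvdp_gcdr /= (dvdp_trans (dvdp_gcdl _ _)) //.
      by rewrite defF dvdp_mulIl.
    exact: (coprimep_dvdr (dvdp_gcdl H Q) (coprimep_dvdl e1 cHg)).
  have cHH : coprimep H H.
    apply: coprimep_dvdl (coprimep_expr n cHQ).
    by apply: dvdp_trans FQn; rewrite defF dvdp_mulIl.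
  case/negP: FnQ; apply: dvdp_trans (dvdp_gcdl Q F); rewrite -/g defF.
  move: cHH; rewrite coprimepp => /size_poly1P[z z0 ->].
  by rewrite mul_polyC dvdpZl.
have gc : root g (c%:~R : 'F_p) by exact: root_dvdp (dvdp_gcdl _ _) d_root.
have Hc : root H (c%:~R : 'F_p) by exact: root_dvdp (dvdp_gcdr _ _) d_root.
have fc : (p%:Z %| f.[c])%Z.
  by rewrite -intr_Fp_eq0 // -horner_map /= -/F defF hornerM (rootP gc) mulr0.
have f'c : (p%:Z %| f^`().[c])%Z.
  rewrite -intr_Fp_eq0 // -horner_map /= -deriv_map -/F defF derivM.
  by rewrite hornerD !hornerM (rootP gc) (rootP Hc) mulr0 mul0r addr0.
have {not_sing}not_sing : ~~ ((p ^ 2)%N%:Z %| f.[c])%Z.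
  by apply/negP=> /not_sing; rewrite f'c.
have [h [_ [defh _]]] := taylor_quotient f c.
(* Modulo [p], [h] is [F / (X - c) = H1 g], a multiple of [gcd (Q, F)]. Lifting a Bezout relation
   gives [U1 q + U2 f = h + p E], and at [x] both [q] and [f] take values divisible by [p]. *)
have [eta etaA defeta] : exists2 eta, eta \in Aint & evalZ x h = p%:R * eta.
  have [H1 defH] := factor_theorem _ _ Hc.
  have defhF : redZ p h = H1 * g.
    have Xc0 : 'X - (c%:~R : 'F_p)%:P != 0 by rewrite polyXsubC_eq0.
    apply: (mulfI Xc0); rewrite mulrA [_ * H1]mulrC -defH -defF /F {1}defh.
    rewrite rmorphD rmorphM rmorphB /= map_polyX !map_polyC /=.
    by move: fc; rewrite -intr_Fp_eq0 // => /eqP ->; rewrite addr0.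
  have [[u1 u2] /= Bez] : exists u, u.1 * Q + u.2 * F = redZ p h.
    have [[v1 v2] /= /eqpP[[k1 k2] /= /andP[k1_0 k2_0] Bg]] := Bezoutp Q F.
    exists (H1 * ((k1 / k2) *: v1), H1 * ((k1 / k2) *: v2)).
    rewrite /= defhF -!mulrA -mulrDr; congr (_ * _).
    by rewrite -!scalerAl -scalerDr mulrC -scalerA Bg scalerA mulVf // scale1r.
  have [[U1 dU1] [U2 dU2]] := (redZ_surj u1, redZ_surj u2).
  have [E defE] : exists E, U1 * q + U2 * f = h + p%:Z *: E.
    by apply: redZ_eq => //; rewrite rmorphD !rmorphM /= dU1 dU2.
  exists (evalZ x U1 * y - evalZ x E).
    by rewrite rpredB ?rpredM ?evalZ_Aint.
  have := congr1 (fun P => evalZ x P) defE.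
  rewrite !rmorphD !rmorphM /= map_polyZ !hornerD !hornerM hornerZ fx mulr0 addr0.
  by rewrite -py mulrBr mulrCA => ->; rewrite addrK.
have [s defs] := dvdzP fc.
have [|N [C /ann[E defE]]] := @Aint_power_relation x eta ('X - c%:P) (- s)%:P etaA.
  apply: (mulfI p0); rewrite mulrCA -defeta map_polyC hornerC.
  have := congr1 (fun P => evalZ x P) defh.
  rewrite fx rmorphD rmorphM /= hornerD hornerM map_polyC hornerC defs.
  move/eqP; rewrite eq_sym addr_eq0 => /eqP ->.
  by rewrite /= rmorphN rmorphM /= mulrN [in RHS]mulrC.
have := congr1 (horner^~ c) defE.
rewrite !hornerE subrr mul0r addr0 => defsn.
case/negP: not_sing; rewrite defs PoszM dvdz_mul //.
have : (p%:Z %| (- s) ^+ N)%Z by rewrite defsn dvdz_mulr.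
rewrite -!intr_Fp_eq0 // rmorphXn rmorphN /= expf_eq0 oppr_eq0.
by case/andP.
Qed.

Lemma singular_point_extra_integer (f : {poly int}) (x : algC) (p : nat) (c : int) :
    prime p -> f \is monic -> x \in Aint -> evalZ x f = 0 ->
    (forall R : {poly int}, evalZ x R = 0 -> exists E, R = f * E) ->
    ((p ^ 2)%N%:Z %| f.[c])%Z -> (p%:Z %| (f^`()).[c])%Z ->
  exists y, [/\ y \in Aint, in_Qtheta x y & ~ in_Ztheta x y].
Proof.
move=> p_pr mf xA fx ann /dvdzP[s defs] /dvdzP[t deft].
have p0 : p%:R != 0 :> algC by rewrite pnatr_eq0 -lt0n prime_gt0.
have redp : (p%:Z%:~R : 'F_p) = 0 by apply/eqP; rewrite intr_Fp_eq0.
have mF : redZ p f \is monic by exact: monic_map.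
have [h [k [defh defk]]] := taylor_quotient f c.
have defF : redZ p f = ('X - (c%:~R)%:P) * redZ p h.
  rewrite {1}defh rmorphD rmorphM rmorphB /= map_polyX !map_polyC /= defs.
  have p2 : (((p ^ 2)%N%:Z)%:~R : 'F_p) = 0.
    by apply/eqP; rewrite intr_Fp_eq0 // dvdzE /= dvdn_exp.
  by rewrite rmorphM /= p2 mulr0 addr0.
exists (evalZ x h / p%:R); split.
- apply: (@Aint_quadratic t%:~R (- (s%:~R * evalZ x k))).
  + by rewrite Aint_int.
  + by rewrite rpredN rpredM ?evalZ_Aint ?Aint_int.
  have evh : (x - c%:~R) * evalZ x h = - (s%:~R * p%:R ^+ 2).
    have := congr1 (fun P => evalZ x P) defh.
    rewrite fx rmorphD rmorphM rmorphB /= map_polyX !map_polyC /= defs !hornerE /=.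
    by move/eqP; rewrite eq_sym addr_eq0 rmorphM /= -!pmulrn natrX => /eqP ->; ring.
  have evk : evalZ x h = (x - c%:~R) * evalZ x k + t%:~R * p%:R.
    rewrite {1}defk rmorphD rmorphM rmorphB /= map_polyX !map_polyC /= deft.
    rewrite !hornerE /=.
    by rewrite rmorphM /= -!pmulrn.
  have h2 : evalZ x h * evalZ x h =
      - (s%:~R * p%:R ^+ 2) * evalZ x k + t%:~R * p%:R * evalZ x h.
    by rewrite {1}evk -evh; ring.
  by rewrite expr_div_n expr2 h2; field.
- exists (p%:R^-1 *: map_poly intr h).
  rewrite map_polyZ hornerZ rmorphV ?unitfE ?pnatr_eq0 -?lt0n ?prime_gt0 //=.
  rewrite rmorph_nat mulrC; congr (_ * _.[_]); rewrite -map_poly_comp.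
  by apply: eq_map_poly => z /=; rewrite ratr_int.
case=> q defq.
have [E defE] : exists E, h - p%:Z *: q = f * E.
  apply: ann; rewrite rmorphB /= map_polyZ hornerD hornerN hornerZ -defq.
  by rewrite /= -pmulrn mulrC divfK ?subrr.
have redh : redZ p h = redZ p f * redZ p E.
  by rewrite -rmorphM -defE rmorphB /= map_polyZ /= redp scale0r subr0.
(* Modulo [p], [f = (X - c) h] with [f] monic, so [h] is nonzero of smaller degree and cannot be a
   multiple of [f]. *)
have h0 : redZ p h != 0.
  apply: contraTneq mF; rewrite defF => ->.
  by rewrite mulr0 monicE lead_coef0 eq_sym oner_eq0.
have : redZ p f %| redZ p h by rewrite redh dvdp_mulIl.
by move/(dvdp_leq h0); rewrite defF size_monicM ?monicXsubC // size_XsubC ltnn.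
Qed.

(** Some nonzero integer multiple of an integral element of [Q(x)] lies in [Z[x]]; the local
    hypothesis strips the prime factors of that multiplier one at a time. *)
Lemma Ztheta_maximal_of_local (x : algC) :
    x \in Aint ->
    (forall p, prime p -> forall y, y \in Aint ->
       in_Ztheta x (p%:R * y) -> in_Ztheta x y) ->
  Ztheta_is_ring_of_integers x.
Proof.
move=> xA loc y; split=> [[q ->]|[[q ->]]].
  split; last exact: evalZ_Aint.
  exists (map_poly intr q); congr _.[_]; rewrite -map_poly_comp.
  by apply: eq_map_poly => z /=; rewrite ratr_int.
have [r [k k0 ->]] := rat_poly_scale q.
set z := _.[x] => zA.
have defz : k%:~R * z = evalZ x r.
  rewrite /z map_polyZ hornerZ fmorphV /= ratr_int mulVKf ?intr_eq0 //.
  by congr _.[_]; rewrite -map_poly_comp; apply: eq_map_poly => w /=; rewrite ratr_int.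
have kz : in_Ztheta x (`|k|%N%:R * z).
  have [kE|kE] : k = `|k|%N%:Z \/ k = - `|k|%N%:Z by lia.
    by exists r; rewrite -defz {2}kE -pmulrn.
  by exists (- r); rewrite rmorphN hornerN -defz {2}kE rmorphN /= -pmulrn mulNr opprK.
have : (0 < `|k|)%N by rewrite absz_gt0.
clearbody z; move: {defz r} `|k|%N kz => n.
have [m] := ubnP n; elim: m => // m IHm in n * => /ltnSE le_nm nz n_gt0.
have [n1|n_neq1] := eqVneq n 1%N; first by move: nz; rewrite n1 mul1r.
have n_gt1 : (1 < n)%N by lia.
have := pdiv_dvd n; case/dvdnP=> d defn.
have p_pr := pdiv_prime n_gt1.
have pgt1 := prime_gt1 p_pr.
apply: (IHm d); [by nia| |by nia].
apply: (loc _ p_pr); first by rewrite rpredM ?rpred_nat.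
by rewrite mulrA -natrM mulnC -defn.
Qed.

(** * The quintic, its derivative and its discriminant *)

Lemma quintic_monic (a b : int) : quintic a b \is monic.
Proof.
rewrite /quintic -addrA monicE lead_coefDl ?lead_coefXn // size_polyXn ltnS.
by rewrite mul_polyC (leq_trans (size_polyD _ _)) // geq_max
  (leq_trans (size_scale_leq _ _)) ?size_polyX // (leq_trans (size_polyC_leq1 _)).
Qed.

Lemma quintic_horner (a b c : int) : (quintic a b).[c] = c ^+ 5 + a * c + b.
Proof. by rewrite /quintic !hornerE. Qed.

Lemma quintic_deriv_horner (a b c : int) : (quintic a b)^`().[c] = 5 * c ^+ 4 + a.
Proof. by rewrite /quintic !derivE !hornerE /=; ring. Qed.

Lemma redZ_quintic (p : nat) (a b : int) :
  redZ p (quintic a b) = 'X^5 + (a%:~R)%:P * 'X + (b%:~R)%:P.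
Proof. by rewrite /quintic !rmorphD rmorphM /= map_polyXn !map_polyC map_polyX. Qed.

Lemma redZ_quintic_deriv (p : nat) (a b : int) :
  (redZ p (quintic a b))^`() = 5%:P * 'X^4 + (a%:~R)%:P.
Proof. by rewrite redZ_quintic !derivE /= polyC_natr; ring. Qed.

(* Expressing [a] and [b] through [f c] and [f' c], the terms of the
   discriminant that are linear in [f' c] and free of [f c] cancel. *)
Lemma quintic_disc_dvd (a b c : int) (p : nat) :
    ((p ^ 2)%N%:Z %| c ^+ 5 + a * c + b)%Z -> (p%:Z %| 5 * c ^+ 4 + a)%Z ->
  ((p ^ 2)%N%:Z %| 2 ^+ 8 * a ^+ 5 + 5 ^+ 5 * b ^+ 4)%Z.
Proof.
move=> /dvdzP[u fc] /dvdzP[v f'c].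
have -> : a = v * p%:Z - 5 * c ^+ 4 by rewrite -f'c; ring.
have -> : b = u * (p ^ 2)%N%:Z - c * (v * p%:Z) + 4 * c ^+ 5.
  by rewrite -fc -f'c; ring.
rewrite expnS expn1 PoszM.
set P := p%:Z.
pose w := 4 * c ^+ 5 - c * v * P.
have -> : 2 ^+ 8 * (v * P - 5 * c ^+ 4) ^+ 5 +
   5 ^+ 5 * (u * (P * P) - c * (v * P) + 4 * c ^+ 5) ^+ 4 =
  P * P * (256 * v ^+ 2 * ((v * P) ^+ 3 - 25 * c ^+ 4 * (v * P) ^+ 2
             + 250 * c ^+ 8 * (v * P) - 1250 * c ^+ 12)
    + 3125 * (c ^+ 2 * v ^+ 2 * ((c * (v * P)) ^+ 2
             - 16 * c ^+ 5 * (c * (v * P)) + 96 * c ^+ 10)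
       + u * (4 * w ^+ 3 + 6 * w ^+ 2 * (u * (P * P))
             + 4 * w * (u * (P * P)) ^+ 2 + (u * (P * P)) ^+ 3))).
  by rewrite /w; ring.
by rewrite dvdz_mulr.
Qed.

(** * Primes dividing [gcd (2a, 5b)] *)

Lemma prime_dvdzM (p : nat) (m n : int) : prime p ->
  (p%:Z %| m * n)%Z = (p%:Z %| m)%Z || (p%:Z %| n)%Z.
Proof. by move=> p_pr; rewrite !dvdzE abszM Euclid_dvdM. Qed.

Lemma prime_dvdzX (p : nat) (m : int) (n : nat) : prime p ->
  (p%:Z %| m ^+ n)%Z = (0 < n)%N && (p%:Z %| m)%Z.
Proof. by move=> p_pr; rewrite !dvdzE abszX /= Euclid_dvdX // andbC. Qed.

Lemma prime_dvd_gcd_cases (a b : int) (p : nat) :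
    prime p -> (p%:Z %| gcdz (2 * a) (5 * b))%Z ->
  [\/ (p%:Z %| a)%Z /\ (p%:Z %| b)%Z,
      [/\ p = 2%N, ~~ (2 %| a)%Z & (2 %| b)%Z] |
      [/\ p = 5%N, (5 %| a)%Z & ~~ (5 %| b)%Z]].
Proof.
move=> p_pr; rewrite dvdz_gcd !prime_dvdzM // => /andP[p2a p5b].
have p2 : (p%:Z %| 2)%Z -> p = 2%N by rewrite dvdzE /= dvdn_prime2 // => /eqP.
have p5 : (p%:Z %| 5)%Z -> p = 5%N by rewrite dvdzE /= dvdn_prime2 // => /eqP.
have [pa|pa] := boolP (p%:Z %| a)%Z; have [pb|pb] := boolP (p%:Z %| b)%Z.
- by constructor 1.
- move: p5b; rewrite (negPf pb) orbF => /p5 defp; subst p; by constructor 3.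
- move: p2a; rewrite (negPf pa) orbF => /p2 defp; subst p; by constructor 2.
by move: p2a p5b; rewrite (negPf pa) (negPf pb) !orbF => /p2 -> .
Qed.

(** Each condition tests explicit points. For [p = 2], [f 1 = 1 + a + b] and [a + b] is odd. For
    [p = 5] and [j = 1, 2, 3, 4], [f (- j) = b - (j^5 + j a)], where [j^5] is [1, 7, 18, 24] modulo
    25: these are the excluded classes. *)
Lemma cond_at_of_nonsingular (a b : int) (p : nat) :
    prime p -> (p%:Z %| gcdz (2 * a) (5 * b))%Z ->
    (forall c : int, ((p ^ 2)%N%:Z %| c ^+ 5 + a * c + b)%Z ->
       ~~ (p%:Z %| 5 * c ^+ 4 + a)%Z) ->
  cond_at a b p.
Proof.
move=> p_pr pg nonsing.
have [[pa pb]|[defp a2 b2]|[defp a5 b5]] := prime_dvd_gcd_cases p_pr pg.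
- left; split=> //; apply: contraL pa => p2b.
  by have := nonsing 0; rewrite !expr0n /= !mulr0 !add0r; apply.
- right; left; split=> //; subst p.
  have := nonsing 1; rewrite !expr1n mulr1; lia.
right; right; split=> //; subst p => k.
rewrite !inE => /or4P[] /eqP ->; apply/negP => /eqP bk.
- by have := nonsing (-1); rewrite -[(-1) ^+ 5]/(-1 : int) -[(-1) ^+ 4]/(1 : int); lia.
- by have := nonsing (-2); rewrite -[(-2) ^+ 5]/(-32 : int) -[(-2) ^+ 4]/(16 : int); lia.
- by have := nonsing (-3); rewrite -[(-3) ^+ 5]/(-243 : int) -[(-3) ^+ 4]/(81 : int); lia.
by have := nonsing (-4); rewrite -[(-4) ^+ 5]/(-1024 : int) -[(-4) ^+ 4]/(256 : int); lia.
Qed.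

(* [c] is the only possible multiple root of [f] modulo [p], and it does not
   lift to a singular point of [f] modulo [p ^ 2]. *)
Definition p_nonsingular (f : {poly int}) (p : nat) (c : int) (m : nat) : Prop :=
  gcdp (redZ p f) (redZ p f)^`() %| ('X - (c%:~R)%:P) ^+ m /\
  (((p ^ 2)%N%:Z %| f.[c])%Z -> ~~ (p%:Z %| (f^`()).[c])%Z).

Lemma nonsingular_of_cond_at (a b : int) (p : nat) :
    prime p -> (p%:Z %| gcdz (2 * a) (5 * b))%Z -> cond_at a b p ->
  exists c m, p_nonsingular (quintic a b) p c m.
Proof.
move=> p_pr pg; rewrite /p_nonsingular.
case=> [[pa pb p2b]|[[defp a2 ab]|[defp b5 bk]]].
- exists 0, 5%N; rewrite quintic_horner expr0n /= mulr0 !add0r; split.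
    (* Modulo [p] the quintic is [X^5]. *)
    move: pa pb; rewrite -!intr_Fp_eq0 // => /eqP a0 /eqP b0.
    by rewrite redZ_quintic a0 b0 mul0r !addr0 subr0 dvdp_gcdl.
  by rewrite (negPf p2b).
- exists 1, 4%N; rewrite quintic_horner expr1n mulr1; split; last by subst p; lia.
  have a1 : a%:~R = 1 :> 'F_p.
    by apply/eqP; rewrite -subr_eq0 -(rmorphB _ a 1) intr_Fp_eq0 // defp; lia.
  have two0 : 2 = 0 :> {poly 'F_p} by rewrite -polyC_natr -{1}defp pchar_Fp_0.
  (* Modulo 2 the derivative is [X^4 + 1 = (X - 1)^4]; the even difference of the two sides is
     displayed below. *)
  suff -> : ('X - 1%:P) ^+ 4 = (redZ p (quintic a b))^`() by exact: dvdp_gcdr.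
  rewrite redZ_quintic_deriv a1 polyC1 polyC_natr.
  transitivity (5 * 'X^4 + 1
    - 2 * (2 * 'X^4 + 2 * 'X^3 - 3 * 'X^2 + 2 * 'X) : {poly 'F_p}).
    by ring.
  by rewrite two0 mul0r subr0.
have a5 : (5 %| a)%Z by case: (prime_dvd_gcd_cases p_pr pg) => [[]|[]|[]]; rewrite defp.
(* The representative [r] of [b] modulo 5 is taken in [1, ..., 4], so that [25 | f (- r)] is exactly
   one of the four excluded congruences. *)
have [r br rE] : exists2 r : int, (5 %| b - r)%Z &
    ~~ (25 %| (- r) ^+ 5 + a * (- r) + b)%Z.
  have : [|| (5 %| b - 1)%Z, (5 %| b - 2)%Z, (5 %| b - 3)%Z | (5 %| b - 4)%Z] by lia.
  case/or4P => br; [exists 1 | exists 2 | exists 3 | exists 4] => //.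
  - rewrite -[(-1) ^+ 5]/(-1 : int).
    by have := bk (1 + a); rewrite !inE eqxx => /(_ isT); lia.
  - rewrite -[(-2) ^+ 5]/(-32 : int).
    by have := bk (7 + 2 * a); rewrite !inE eqxx orbT => /(_ isT); lia.
  - rewrite -[(-3) ^+ 5]/(-243 : int).
    by have := bk (18 + 3 * a); rewrite !inE eqxx !orbT => /(_ isT); lia.
  - rewrite -[(-4) ^+ 5]/(-1024 : int).
    by have := bk (24 + 4 * a); rewrite !inE eqxx !orbT => /(_ isT); lia.
exists (- r), 5%N; rewrite quintic_horner; subst p; split; last by rewrite (negPf rE).
have a0 : a%:~R = 0 :> 'F_5 by apply/eqP; rewrite intr_Fp_eq0.
have bE : b%:~R = r%:~R :> 'F_5.
  by apply/eqP; rewrite -subr_eq0 -rmorphB intr_Fp_eq0.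
have five0 : 5 = 0 :> {poly 'F_5} by rewrite -polyC_natr pchar_Fp_0.
(* Modulo 5 the quintic is [X^5 + r], which equals [(X + r)^5] by Frobenius and [r^5 = r]. *)
suff -> : ('X - ((- r)%:~R)%:P) ^+ 5 = redZ 5 (quintic a b) by exact: dvdp_gcdl.
rewrite redZ_quintic a0 bE mul0r addr0 rmorphN /= polyCN opprK.
have : (r%:~R : 'F_5) ^+ 5 = r%:~R.
  by case: (r%:~R : 'F_5) => [[|[|[|[|[|?]]]]]] i //; apply/val_inj.
move: (r%:~R : 'F_5) => s s5; rewrite -{2}s5 rmorphXn /=.
transitivity ('X^5 + s%:P ^+ 5 + 5 * ('X^4 * s%:P + 2 * 'X^3 * s%:P ^+ 2
   + 2 * 'X^2 * s%:P ^+ 3 + 'X * s%:P ^+ 4)); first by ring.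
by rewrite five0 mul0r addr0.
Qed.

Lemma nonsingular_of_disc (a b : int) (p : nat) :
    prime p -> ~~ (p%:Z %| gcdz (2 * a) (5 * b))%Z ->
    ~~ ((p ^ 2)%N%:Z %| 2 ^+ 8 * a ^+ 5 + 5 ^+ 5 * b ^+ 4)%Z ->
  exists c m, p_nonsingular (quintic a b) p c m.
Proof.
move=> p_pr pg pD; rewrite /p_nonsingular.
set F := redZ p _.
have gcd_lin : gcdp F F^`() %| (4 * a%:~R) *: 'X + (5 * b%:~R)%:P.
  have -> : (4 * a%:~R) *: 'X + (5 * b%:~R)%:P = 5%:P * F - 'X * F^`().
    rewrite /F redZ_quintic_deriv redZ_quintic -mul_polyC !polyCM !polyC_natr.
    by ring.
  by rewrite dvdp_sub ?dvdp_mull ?dvdp_gcdl ?dvdp_gcdr.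
have intrM (k : nat) (z : int) : k%:R * z%:~R = (k%:Z * z)%:~R :> 'F_p.
  by rewrite rmorphM /= -pmulrn.
have [p2a|p2a] := boolP (p%:Z %| 2 * a)%Z.
  (* Here [4 a] vanishes modulo [p] while [5 b] does not, so the gcd is constant: [m = 0] suffices,
     with an arbitrary [c]. *)
  exists 0, 0%N; split.
    apply: dvdp_trans gcd_lin _.
    have -> : 4 * a%:~R = 0 :> 'F_p.
      apply/eqP; rewrite intrM intr_Fp_eq0 // -[4%N%:Z]/(2 * 2 : int) -mulrA.
      by rewrite prime_dvdzM // p2a orbT.
    rewrite scale0r add0r expr0 dvdp1 size_polyC intrM intr_Fp_eq0 //.
    by move: pg; rewrite dvdz_gcd p2a /= => ->.
  rewrite quintic_horner quintic_deriv_horner => h1.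
  by apply: contra pD; exact: quintic_disc_dvd.
have a4 : 4 * a%:~R != 0 :> 'F_p.
  rewrite intrM intr_Fp_eq0 // -[4%N%:Z]/(2 * 2 : int) -mulrA prime_dvdzM //.
  by move: p2a; rewrite prime_dvdzM // negb_or => /andP[/negPf -> /negPf ->].
(* The root of the linear form [4 a X + 5 b], which is then a scalar multiple of [X - z]. *)
pose z : 'F_p := - (5 * b%:~R) / (4 * a%:~R).
exists (z : nat)%:Z, 1%N; split.
  apply: dvdp_trans gcd_lin _.
  rewrite -pmulrn natr_Zp expr1.
  rewrite -(dvdpZr _ _ a4) scalerBr -[(_ * _) *: z%:P]mul_polyC -polyCM.
  have -> : 4 * a%:~R * z = - (5 * b%:~R) by rewrite mulrC divfK.
  by rewrite polyCN opprK.
rewrite quintic_horner quintic_deriv_horner => h1.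
by apply: contra pD; exact: quintic_disc_dvd.
Qed.

(** A prime dividing both [2^8 a^5] and [5^5 b^4] divides [2 a] and [5 b]. So [p] is prime to the
    gcd [g], and [p^2 | D] would pass to the square-free quotient [D / g]. *)
Lemma disc_sqfree_away (a b : int) (p : nat) :
    squarefree `|((2 ^+ 8 * a ^+ 5 + 5 ^+ 5 * b ^+ 4)
                 %/ gcdz (2 ^+ 8 * a ^+ 5) (5 ^+ 5 * b ^+ 4))%Z|%N ->
    prime p -> ~~ (p%:Z %| gcdz (2 * a) (5 * b))%Z ->
  ~~ ((p ^ 2)%N%:Z %| 2 ^+ 8 * a ^+ 5 + 5 ^+ 5 * b ^+ 4)%Z.
Proof.
move=> [_ sqf] p_pr pg; have := sqf p p_pr; apply: contra.
set g := gcdz _ _; set D := _ + _ => p2D.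
have gD : (g %| D)%Z by rewrite rpredD ?dvdz_gcdl ?dvdz_gcdr.
have ng : ~~ (p%:Z %| g)%Z.
  by apply: contra pg; rewrite !dvdz_gcd !(prime_dvdzM, prime_dvdzX) // !orbb.
have absD : `|D|%N = (`|(D %/ g)%Z| * `|g|)%N by rewrite -abszM divzK.
move: p2D; rewrite dvdzE absD /= Gauss_dvdl //.
by rewrite coprimeXl // prime_coprime.
Qed.

Theorem theorem3p1 (a b : int) (theta : algC) :
  irreducible_in_Zx (quintic a b) ->
  root (map_poly intr (quintic a b)) theta ->
  squarefree `|((2 ^+ 8 * a ^+ 5 + 5 ^+ 5 * b ^+ 4)
                 %/ gcdz (2 ^+ 8 * a ^+ 5) (5 ^+ 5 * b ^+ 4))%Z|%N ->
  (Ztheta_is_ring_of_integers theta <->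
   forall p : nat, prime p -> (p%:Z %| gcdz (2 * a) (5 * b))%Z -> cond_at a b p).
Proof.
move=> irr /rootP fx sqf.
have mf := quintic_monic a b.
have xA : theta \in Aint.
  by apply/Aint_integralOver; exists (quintic a b) => //; apply/rootP.
have ann R : evalZ theta R = 0 -> exists E, R = quintic a b * E.
  exact: irreducible_dvd_annihilator.
split=> [maxi p p_pr pg|cond].
  apply: cond_at_of_nonsingular => // c.
  rewrite -quintic_horner -(quintic_deriv_horner a b) => fc; apply/negP => f'c.
  have [y [yA yQ]] := singular_point_extra_integer p_pr mf xA fx ann fc f'c.
  by apply; apply/maxi.
apply: Ztheta_maximal_of_local => // p p_pr.
suff [c [m [gcd_dvd nonsing]]] : exists c m, p_nonsingular (quintic a b) p c m.
  exact: dedekind_local gcd_dvd nonsing.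
have [pg|pg] := boolP (p%:Z %| gcdz (2 * a) (5 * b))%Z.
  exact: nonsingular_of_cond_at (cond p p_pr pg).
exact/nonsingular_of_disc/disc_sqfree_away.
Qed.
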